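(* Let $k\ge 1$ be an integer. For either choice of sign, the residual of GMRES applied to the preconditioned system with coefficient matrix $\mathcal{P}_{L^{\pm}}^{-1}\mathcal{A}$ (with nonzero initial residual $\mathbf{r}_0$) is bounded by $$\frac{\|\mathbf{r}_k\|}{\|\mathbf{r}_0\|}\le\left(1+\|A^{-1}B^T\|+\|\hat S^{-1}S\|\right)\min_{\substack{p\in\mathbb{P}_{k-1}\\ p(0)=1}}\|p(\hat S^{-1}S)\|,$$ where $\mathbb{P}_{k-1}$ denotes the set of polynomials of degree up to $k-1$.
   Context: Consider a general saddle point matrix $$\mathcal{A}=\begin{bmatrix}A&B^T\\C&-D\end{bmatrix},$$ with $A\in\mathbb{R}^{n\times n}$ nonsingular, $B,C\in\mathbb{R}^{m\times n}$, $D\in\mathbb{R}^{m\times m}$. No symmetry is assumed, $B$ and $C$ need not have full rank, and the Schur complement need not be nonsingular. Put $S=D+CA^{-1}B^T$. Let $\hat S\in\mathbb{R}^{m\times m}$ be nonsingular (an approximation to $S$) and $$\mathcal{P}_{L^{\pm}}=\begin{bmatrix}A&0\\C&\pm\hat S\end{bmatrix}.$$ $\|\cdot\|$ is the Euclidean vector norm and the induced matrix norm. $\mathbf{r}_k$ is the residual after $k$ steps of (unrestarted) GMRES for a linear system with coefficient matrix $\mathcal{P}_{L^{\pm}}^{-1}\mathcal{A}$: $\|\mathbf{r}_k\|=\min\{\|p(\mathcal{P}_{L^{\pm}}^{-1}\mathcal{A})\mathbf{r}_0\|:\ p\in\mathbb{P}_k,\ p(0)=1\}$. *)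

(* Defs.v *)
From HB Require Import structures.
From mathcomp Require Import all_boot all_order all_algebra.
From mathcomp Require Import boolp classical_sets reals.

Set Implicit Arguments.
Unset Strict Implicit.
Unset Printing Implicit Defensive.

Import Order.TTheory GRing.Theory Num.Theory.
Local Open Scope classical_set_scope.
Local Open Scope ring_scope.

(* The norm `|x| that MathComp-Analysis puts on matrices is the max norm, hence
   the two definitions below. *)
Definition norm2 (R : realType) (n : nat) (x : 'cV[R]_n) : R :=
  Num.sqrt (\sum_(i < n) x i 0 ^+ 2).

(* The closed unit ball, unlike the unit sphere, is nonempty when n = 0. *)
Definition opnorm2 (R : realType) (m n : nat) (A : 'M[R]_(m, n)) : R :=
  sup [set norm2 (A *m x) | x in [set x : 'cV[R]_n | norm2 x <= 1]].

(* horner_mx only applies to matrices of size n.+1. *)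
Definition mxpoly_eval (R : realType) (n : nat) (p : {poly R}) (A : 'M[R]_n) :
    'M[R]_n :=
  \sum_(i < size p) p`_i *: A ^+ i.

Definition residual_poly (R : realType) (k : nat) : set {poly R} :=
  [set p : {poly R} | (size p <= k.+1)%N /\ p.[0] = 1].

Definition is_minimum (R : realType) (E : set R) (mu : R) : Prop :=
  E mu /\ lbound E mu.

(* r is the residual after k steps of unrestarted GMRES for a linear system with
   coefficient matrix M and initial residual r0. *)
Definition gmres_residual (R : realType) (N : nat) (M : 'M[R]_N)
    (r0 : 'cV[R]_N) (k : nat) (r : 'cV[R]_N) : Prop :=
  [set mxpoly_eval p M *m r0 | p in residual_poly k] r /\
  is_minimum [set norm2 (mxpoly_eval p M *m r0) | p in residual_poly k]
             (norm2 r).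

Definition saddle_mx (R : realType) (n m : nat)
    (A : 'M[R]_n) (B C : 'M[R]_(m, n)) (D : 'M[R]_m) : 'M[R]_(n + m) :=
  block_mx A B^T C (- D).

Definition schur_mx (R : realType) (n m : nat)
    (A : 'M[R]_n) (B C : 'M[R]_(m, n)) (D : 'M[R]_m) : 'M[R]_m :=
  D + C *m invmx A *m B^T.

(* The lower right block is + Shat for neg = false, - Shat for neg = true. *)
Definition precond_mx (R : realType) (n m : nat) (neg : bool)
    (A : 'M[R]_n) (C : 'M[R]_(m, n)) (Shat : 'M[R]_m) : 'M[R]_(n + m) :=
  block_mx A 0 C ((-1) ^+ neg *: Shat).

(* Main.v *)
(* Write T = Shat^-1 S, X = A^-1 B^T and let c = -1 or 1 for the sign + or - of
   the preconditioner. The preconditioned matrix is M = [[1, X], [0, c T]].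
   For p with p(0) = 1 the polynomial q(z) = (1 - z) p(c z) has degree one more
   and q(0) = 1; the factor 1 - z kills the leading identity block, so that
   q(M) = [[0, -X p(T)], [0, (1 - c T) p(T)]], whose norm is at most
   (|X| + 1 + |T|) |p(T)|.
   The minimum over p is attained because the matrices p(T) form an affine
   subspace of a finite-dimensional space, on which sublevel sets of the norm
   are compact. *)
Require Import Defs.
From mathcomp Require Import all_boot all_order all_algebra.
From mathcomp Require Import boolp classical_sets reals.
From mathcomp Require Import topology normedtype derive.
From mathcomp Require Import ring.

Set Implicit Arguments.
Unset Strict Implicit.
Unset Printing Implicit Defensive.

Import Order.TTheory GRing.Theory Num.Theory.
Import numFieldNormedType.Exports.
Local Open Scope classical_set_scope.
Local Open Scope ring_scope.

(** * Euclidean norm of column vectors *)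

Lemma norm2_ge0 (R : realType) n (x : 'cV[R]_n) : 0 <= norm2 x.
Proof. exact: sqrtr_ge0. Qed.

Lemma norm2_sqr (R : realType) n (x : 'cV[R]_n) :
  norm2 x ^+ 2 = \sum_i x i 0 ^+ 2.
Proof. by rewrite sqr_sqrtr // sumr_ge0 // => i _; exact: sqr_ge0. Qed.

Lemma norm20 (R : realType) n : norm2 (0 : 'cV[R]_n) = 0.
Proof.
by rewrite /norm2 big1 ?sqrtr0 // => i _; rewrite mxE expr0n.
Qed.

Lemma norm2_eq0 (R : realType) n (x : 'cV[R]_n) : norm2 x = 0 -> x = 0.
Proof.
move=> x0; have := norm2_sqr x; rewrite x0 expr0n /= => /esym/eqP.
rewrite psumr_eq0 => [/allP h|i _]; last exact: sqr_ge0.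
apply/colP => i; rewrite mxE; apply/eqP; rewrite -sqrf_eq0.
exact: (implyP (h i (mem_index_enum i))).
Qed.

Lemma norm2Z (R : realType) n a (x : 'cV[R]_n) :
  norm2 (a *: x) = `|a| * norm2 x.
Proof.
rewrite /norm2 -sqrtr_sqr -sqrtrM ?sqr_ge0 // mulr_sumr.
by congr Num.sqrt; apply: eq_bigr => i _; rewrite mxE exprMn.
Qed.

Lemma norm2_Cauchy_Schwarz (R : realType) n (x y : 'cV[R]_n) :
  \sum_i x i 0 * y i 0 <= norm2 x * norm2 y.
Proof.
have [/norm2_eq0 -> | x0] := eqVneq (norm2 x) 0.
  by rewrite norm20 mul0r big1 // => i _; rewrite mxE mul0r.
(* [d] is kept opaque, so that distributing sums does not unfold it. *)
have [d dE] : {d | d = \sum_i x i 0 * y i 0} by exists (\sum_i x i 0 * y i 0).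
rewrite -dE.
have s0 : 0 < norm2 x ^+ 2 by rewrite exprn_gt0 // lt_def x0 norm2_ge0.
(* The vector [norm2 x ^+ 2 *: y - d *: x] is the part of [y] orthogonal to [x], up to a factor;
   expanding its squared norm gives the claim. *)
have : 0 <= \sum_i (norm2 x ^+ 2 * y i 0 - d * x i 0) ^+ 2.
  by apply: sumr_ge0 => i _; exact: sqr_ge0.
have -> : \sum_i (norm2 x ^+ 2 * y i 0 - d * x i 0) ^+ 2 =
    norm2 x ^+ 2 * ((norm2 x * norm2 y) ^+ 2 - d ^+ 2).
  transitivity ((norm2 x ^+ 2) ^+ 2 * (\sum_i y i 0 ^+ 2)
      - 2 * norm2 x ^+ 2 * d * (\sum_i x i 0 * y i 0)
      + d ^+ 2 * (\sum_i x i 0 ^+ 2)).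
    rewrite !mulr_sumr -sumrN -!big_split /=.
    by apply: eq_bigr => i _; ring.
  by rewrite -dE -!norm2_sqr; ring.
rewrite pmulr_rge0 // subr_ge0 => h.
rewrite (le_trans (ler_norm _)) // -ler_sqr ?nnegrE ?mulr_ge0 ?norm2_ge0 //.
by rewrite real_normK ?num_real.
Qed.

Lemma norm2D (R : realType) n (x y : 'cV[R]_n) :
  norm2 (x + y) <= norm2 x + norm2 y.
Proof.
rewrite -ler_sqr ?nnegrE ?addr_ge0 ?norm2_ge0 // sqrrD !norm2_sqr.
have -> : \sum_i (x + y) i 0 ^+ 2 =
    \sum_i x i 0 ^+ 2 + (\sum_i x i 0 * y i 0) *+ 2 + \sum_i y i 0 ^+ 2.
  by rewrite -sumrMnl -!big_split /=; apply: eq_bigr => i _; rewrite mxE sqrrD.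
by rewrite lerD2r lerD2l lerMn2r norm2_Cauchy_Schwarz.
Qed.

Lemma norm2_sum (R : realType) n (I : finType) (F : I -> 'cV[R]_n) :
  norm2 (\sum_i F i) <= \sum_i norm2 (F i).
Proof.
elim/big_ind2: _ => [|a b c d ab cd|//]; first by rewrite norm20.
exact: le_trans (norm2D _ _) (lerD ab cd).
Qed.

Lemma entry_le_norm2 (R : realType) n (x : 'cV[R]_n) i : `|x i 0| <= norm2 x.
Proof.
rewrite -sqrtr_sqr ler_sqrt; last by apply: sumr_ge0 => j _; exact: sqr_ge0.
by rewrite (bigD1 i) //= lerDl sumr_ge0 // => j _; exact: sqr_ge0.
Qed.

Lemma norm2_col_mx (R : realType) m n (x : 'cV[R]_m) (y : 'cV[R]_n) :
  norm2 (col_mx x y) ^+ 2 = norm2 x ^+ 2 + norm2 y ^+ 2.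
Proof.
rewrite !norm2_sqr big_split_ord /=.
by congr (_ + _); apply: eq_bigr => i _; rewrite ?col_mxEu ?col_mxEd.
Qed.

Lemma norm2_col_mx_le (R : realType) m n (x : 'cV[R]_m) (y : 'cV[R]_n) :
  norm2 (col_mx x y) <= norm2 x + norm2 y.
Proof.
rewrite -ler_sqr ?nnegrE ?addr_ge0 ?norm2_ge0 // norm2_col_mx sqrrD.
by rewrite lerD2r lerDl mulrn_wge0 // mulr_ge0 ?norm2_ge0.
Qed.

Lemma norm2_dsubmx_le (R : realType) m n (x : 'cV[R]_(m + n)) :
  norm2 (dsubmx x) <= norm2 x.
Proof.
rewrite -[X in _ <= norm2 X]vsubmxK -ler_sqr ?nnegrE ?norm2_ge0 //.
by rewrite norm2_col_mx lerDr sqr_ge0.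
Qed.

(** * Induced operator norm *)

(** This makes [sup] a genuine least upper bound. On the unit ball every coordinate of [x] is at
    most 1 in absolute value, so the sum of the column norms is an upper bound. *)
Lemma opnorm2_has_sup (R : realType) m n (A : 'M[R]_(m, n)) :
  has_sup [set norm2 (A *m x) | x in [set x : 'cV[R]_n | norm2 x <= 1]].
Proof.
split.
  by exists (norm2 (A *m 0)); exists 0 => //=; rewrite norm20.
exists (\sum_j norm2 (col j A)) => _ [x /= x1 <-].
have -> : A *m x = \sum_j x j 0 *: col j A.
  apply/colP => i; rewrite mxE summxE; apply: eq_bigr => j _.
  by rewrite !mxE mulrC.
apply: le_trans (norm2_sum _) _; apply: ler_sum => j _.
rewrite norm2Z ler_piMl ?norm2_ge0 //.
exact: le_trans (entry_le_norm2 _ _) x1.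
Qed.

Lemma norm2_mulmx (R : realType) m n (A : 'M[R]_(m, n)) (x : 'cV[R]_n) :
  norm2 (A *m x) <= opnorm2 A * norm2 x.
Proof.
have [/norm2_eq0 -> | x0] := eqVneq (norm2 x) 0.
  by rewrite mulmx0 !norm20 mulr0.
have xgt0 : 0 < norm2 x by rewrite lt_def x0 norm2_ge0.
rewrite -ler_pdivrMr // mulrC -[X in X * _]ger0_norm ?invr_ge0 ?norm2_ge0 //.
rewrite -norm2Z scalemxAr; apply: ub_le_sup; first by case: (opnorm2_has_sup A).
exists ((norm2 x)^-1 *: x) => //=.
by rewrite norm2Z ger0_norm ?invr_ge0 ?norm2_ge0 // mulVf.
Qed.

Lemma opnorm2_ge0 (R : realType) m n (A : 'M[R]_(m, n)) : 0 <= opnorm2 A.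
Proof.
apply: ub_le_sup; first by case: (opnorm2_has_sup A).
by exists 0; rewrite /= ?mulmx0 norm20.
Qed.

Lemma opnorm2_le (R : realType) m n (A : 'M[R]_(m, n)) c : 0 <= c ->
  (forall x, norm2 (A *m x) <= c * norm2 x) -> opnorm2 A <= c.
Proof.
move=> c0 Ac; apply: ge_sup; first by case: (opnorm2_has_sup A).
by move=> _ [x /= x1 <-]; apply: le_trans (Ac x) _; rewrite ler_piMr.
Qed.

Lemma opnorm2D (R : realType) m n (A B : 'M[R]_(m, n)) :
  opnorm2 (A + B) <= opnorm2 A + opnorm2 B.
Proof.
apply: opnorm2_le => [|x]; first by rewrite addr_ge0 ?opnorm2_ge0.
rewrite mulmxDl mulrDl; apply: le_trans (norm2D _ _) _.
by rewrite lerD ?norm2_mulmx.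
Qed.

Lemma opnorm2Z (R : realType) m n a (A : 'M[R]_(m, n)) :
  opnorm2 (a *: A) <= `|a| * opnorm2 A.
Proof.
apply: opnorm2_le => [|x]; first by rewrite mulr_ge0 ?opnorm2_ge0.
by rewrite -scalemxAl norm2Z -mulrA ler_wpM2l ?norm2_mulmx.
Qed.

Lemma entry_le_opnorm2 (R : realType) m n (A : 'M[R]_(m, n)) i j :
  `|A i j| <= opnorm2 A.
Proof.
have -> : A i j = (A *m (delta_mx j 0 : 'cV_n)) i 0 by rewrite -colE mxE.
apply: le_trans (entry_le_norm2 _ _) _.
apply: le_trans (norm2_mulmx _ _) _.
rewrite ler_piMr ?opnorm2_ge0 // /norm2 (bigD1 j) //= mxE !eqxx expr1n.
rewrite big1 ?addr0 ?sqrtr1 // => l lj.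
by rewrite mxE (negbTE lj) expr0n.
Qed.

(** * Continuity of seminorms with respect to the max norm *)

Lemma entry_le_mx_norm (R : realType) m n (A : 'M[R]_(m, n)) i j :
  `|A i j| <= `|A|.
Proof.
by rewrite [leRHS]/Num.norm /= mx_normrE; apply/bigmax_geP; right; exists (i, j).
Qed.

Lemma lipschitz_continuous (R : realType) (V : normedModType R) (f : V -> R) K :
  0 <= K -> (forall x y, f x - f y <= `|x - y| * K) -> continuous f.
Proof.
move=> K0 fB u; apply/cvgrPdist_lt => e e0.
(* [K + 1] is a positive divisor even when [K] is 0. *)
have Kp : 0 < K + 1 by rewrite ltr_wpDl.
have d0 : 0 < e / (K + 1) by rewrite divr_gt0.
apply: filterS (nbhsx_ballx u _ d0) => v; rewrite -ball_normE /= ltr_pdivlMr //.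
apply: le_lt_trans; apply: (@le_trans _ _ (`|u - v| * K)).
  by rewrite ler_norml lerNl opprB fB distrC fB.
by rewrite ler_wpM2l // lerDl.
Qed.

(** Expanding [u] in the standard basis bounds [f u] by [K] times the max norm of [u]; subadditivity
    then makes [f] Lipschitz. *)
Lemma seminorm_continuous (R : realType) n (f : 'rV[R]_n -> R)
    (a : 'rV[R]_n) :
  (forall u v, f (u + v) <= f u + f v) ->
  (forall a u, f (a *: u) <= `|a| * f u) ->
  continuous (fun u => f (a + u)).
Proof.
move=> fD fZ.
have f0 : f 0 <= 0 by have := fZ 0 0; rewrite scale0r normr0 mul0r.
pose K := \sum_i `|f (delta_mx 0 i)|.
have K0 : 0 <= K by apply: sumr_ge0.
have fK u : f u <= `|u| * K.
  rewrite [X in f X]row_sum_delta mulr_sumr.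
  elim/big_ind2: _ => [//|b c d e bc de|i _].
    exact: le_trans (fD _ _) (lerD bc de).
  apply: le_trans (fZ _ _) _.
  apply: le_trans (ler_wpM2l _ (ler_norm _)) _ => //.
  by rewrite ler_wpM2r // entry_le_mx_norm.
apply: (lipschitz_continuous K0) => u v.
rewrite lerBlDr -{1}(subrK v u) addrCA (le_trans (fD _ _)) //.
by rewrite lerD2r fK.
Qed.

(** * Polynomials evaluated at matrices *)

Lemma mxpoly_eval_wide (R : realType) n (p : {poly R}) (A : 'M[R]_n) l :
  (size p <= l)%N -> mxpoly_eval p A = \sum_(i < l) p`_i *: A ^+ i.
Proof.
move=> pl; rewrite /mxpoly_eval.
rewrite (big_ord_widen l (fun i => p`_i *: A ^+ i)) // big_mkcond /=.
apply: eq_bigr => i _; case: ltnP => // /(nth_default 0) ->.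
by rewrite scale0r.
Qed.

(** Gives access to the ring morphism [horner_mx]; in size 0 all matrices coincide. *)
Lemma mxpoly_eval_horner (R : realType) n (p : {poly R}) (A : 'M[R]_n.+1) :
  mxpoly_eval p A = horner_mx A p.
Proof.
rewrite -[p in RHS]coefK poly_def linear_sum; apply: eq_bigr => i _.
by rewrite linearZ rmorphXn /= horner_mx_X.
Qed.

Lemma mxpoly_evalM (R : realType) n (p q : {poly R}) (A : 'M[R]_n) :
  mxpoly_eval (p * q) A = mxpoly_eval p A *m mxpoly_eval q A.
Proof.
case: n A => [|n] A; first by rewrite !flatmx0.
by rewrite !mxpoly_eval_horner rmorphM.
Qed.

Lemma mxpoly_eval1BX (R : realType) n (A : 'M[R]_n) :
  mxpoly_eval (1 - 'X) A = 1%:M - A.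
Proof.
case: n A => [|n] A; first by rewrite [LHS]flatmx0 [RHS]flatmx0.
by rewrite mxpoly_eval_horner rmorphB /= rmorph1 horner_mx_X.
Qed.

(** [Z] and [W] can stay anonymous: the factor [1 - M], whose first block column is zero, will
    annihilate them. *)
Lemma mxpoly_eval_block (R : realType) n m (p : {poly R})
    (X : 'M[R]_(n, m)) (Y : 'M[R]_m) :
  exists Z W, mxpoly_eval p (block_mx 1%:M X 0 Y) =
            block_mx Z W 0 (mxpoly_eval p Y).
Proof.
have hpow i : exists Z, (block_mx 1%:M X 0 Y) ^+ i = block_mx 1%:M Z 0 (Y ^+ i).
  elim: i => [|i [Z IH]]; first by exists 0; rewrite !expr0 -scalar_mx_block.
  exists (Z + X *m Y ^+ i); rewrite !exprS IH -!mulmxE mulmx_block.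
  by rewrite !mul1mx !mul0mx !mulmx0 addr0 !add0r.
rewrite /mxpoly_eval; elim/big_ind2: _ => [|A B C D [Z [W ->]] [Z' [W' ->]]|i _].
- by exists 0, 0; rewrite block_mx0.
- by exists (Z + Z'), (W + W'); rewrite add_block_mx addr0.
- have [Z ->] := hpow i; exists (p`_i *: 1%:M), (p`_i *: Z).
  by rewrite scale_block_mx scaler0.
Qed.

(** * Attainment of the minimum over residual polynomials *)

(** The minimum is sought over [u = v *m G] rather than over [v]: the rows of [G] may be dependent,
    and then sublevel sets in [v] are unbounded. *)
Lemma seminorm_affine_min (R : realType) l n (f : 'rV[R]_n -> R)
    (a : 'rV[R]_n) (G : 'M[R]_(l, n)) :
  (forall u v, f (u + v) <= f u + f v) ->
  (forall c u, f (c *: u) <= `|c| * f u) ->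
  (forall u, `|u| <= f u) ->
  exists v, forall w, f (a + v *m G) <= f (a + w *m G).
Proof.
move=> fD fZ f_ge.
have facont := seminorm_continuous (a := a) fD fZ.
(* [g] vanishes exactly on the row space of [G], so [g u <= 0] states membership as a closed
   condition. *)
pose g (u : 'rV[R]_n) := `|u *m cokermx G|.
have gcont : continuous g.
  have -> : g = fun u => g (0 + u) by apply/funext => u; rewrite add0r.
  apply: seminorm_continuous => [u v|c u].
    by rewrite /g mulmxDl ler_normD.
  by rewrite /g -scalemxAl normrZ.
pose E := [set u : 'rV[R]_n | g u <= 0] `&` [set u | f (a + u) <= f a].
have Ecomp : compact E.
  apply: bounded_closed_compact.
    exists (f a + `|a|); split; first exact: num_real.
    move=> M Mgt u [_ /= fu]; apply: le_trans (ltW Mgt).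
    rewrite -[u](addKr a) addrC; apply: le_trans (ler_normB _ _) _.
    by rewrite lerD2r (le_trans (f_ge _)).
  apply: closedI.
    exact: (iffLR (continuous_closedP g)) gcont _ (@closed_le R 0).
  exact: (iffLR (continuous_closedP _)) facont _ (@closed_le R (f a)).
have E0 : E 0.
  by split; rewrite /= ?addr0 // /g mul0mx normr0.
have [u /[!inE] -[/= gu fu] umin] :=
  EVT_min_rV (ex_intro _ _ E0) Ecomp (continuous_subspaceT facont).
have /submxP[v uE] : (u <= G)%MS by rewrite submxE -normr_le0.
exists v => w; rewrite -uE.
(* Points outside the sublevel set of [f a] lose to [u], since [f (a + u) <= f a]. *)
have [wa|wa] := leP (f (a + w *m G)) (f a); last exact: le_trans fu (ltW wa).
apply: umin; rewrite inE; split => //=.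
by rewrite /g -mulmxA mulmx_coker mulmx0 normr0.
Qed.

(** The condition at 0 fixes the constant coefficient, and the other [k] coefficients are free
    parameters along the vectorised powers [T], ..., [T ^+ k]. *)
Lemma mxpoly_eval_affine (R : realType) m k (p : {poly R}) (T : 'M[R]_m) :
  (size p <= k.+1)%N -> p.[0] = 1 ->
  mxpoly_eval p T =
  vec_mx (mxvec 1%:M
    + (\row_i p`_i.+1) *m (\matrix_(i < k) mxvec (T ^+ i.+1))).
Proof.
move=> pk; rewrite horner_coef0 => p0.
rewrite (mxpoly_eval_wide _ pk) big_ord_recl expr0 p0 scale1r.
rewrite linearD /= mxvecK; congr (_ + _).
rewrite mulmx_sum_row linear_sum; apply: eq_bigr => i _.
by rewrite linearZ /= rowK mxvecK mxE.
Qed.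

(** The coercivity hypothesis of [seminorm_affine_min] for the operator norm. *)
Lemma mx_norm_le_opnorm2 (R : realType) m n (u : 'rV[R]_(m * n)) :
  `|u| <= opnorm2 (vec_mx u).
Proof.
rewrite [leLHS]/Num.norm /= mx_normrE; apply/bigmax_leP; split=> [|[i j] _ /=].
  exact: opnorm2_ge0.
rewrite ord1; case/mxvec_indexP: j => i1 i2.
by rewrite -[u in leLHS]vec_mxK mxvecE entry_le_opnorm2.
Qed.

Lemma residual_poly_opnorm2_min (R : realType) m k (T : 'M[R]_m) :
  exists mu : R, is_minimum
    [set opnorm2 (mxpoly_eval p T) | p in residual_poly k] mu.
Proof.
pose f (u : 'rV[R]_(m * m)) := opnorm2 (vec_mx u).
pose G := \matrix_(i < k) mxvec (T ^+ i.+1).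
have [|||v vmin] := @seminorm_affine_min R k _ f (mxvec 1%:M) G.
- by move=> u v; rewrite /f linearD opnorm2D.
- by move=> c u; rewrite /f linearZ opnorm2Z.
- exact: mx_norm_le_opnorm2.
exists (f (mxvec 1%:M + v *m G)); split.
  (* The minimising coefficient vector is turned back into a polynomial with constant term 1. *)
  pose p := 1 + 'X * rVpoly v.
  have pk : (size p <= k.+1)%N.
    rewrite (leq_trans (size_polyD _ _)) // size_poly1 geq_max /=.
    rewrite mulrC (leq_trans (size_mul_leq _ _)) // size_polyX addn2 /=.
    by rewrite ltnS size_poly.
  have p0 : p.[0] = 1 by rewrite !hornerE.
  have pv : \row_i p`_i.+1 = v.
    by apply/rowP => i; rewrite mxE coefD coef1 coefXM /= add0r coef_rVpoly_ord.
  by exists p => //; rewrite (mxpoly_eval_affine _ pk p0) pv.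
by move=> _ [p [pk p0] <-]; rewrite (mxpoly_eval_affine _ pk p0) vmin.
Qed.

(** * The preconditioned matrix and the residual bound *)

Lemma precond_saddle_mx (R : realType) (n m : nat)
    (A : 'M[R]_n) (B C : 'M[R]_(m, n)) (D Shat : 'M[R]_m) (neg : bool) :
  A \in unitmx -> Shat \in unitmx ->
  invmx (precond_mx neg A C Shat) *m saddle_mx A B C D =
  block_mx 1%:M (invmx A *m B^T)
           0 (- (-1) ^+ neg *: (invmx Shat *m schur_mx A B C D)).
Proof.
move=> uA uS.
have uP : precond_mx neg A C Shat \in unitmx.
  rewrite unitmxE det_lblock detZ !unitrM -!unitmxE uA uS andbT /=.
  by rewrite -signr_odd unitrX // unitrX // unitrN1.
(* After multiplication by the preconditioner, the two signs combine to -1, and the lower right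
   block becomes [C *m invmx A *m B^T - S], that is [- D]. *)
apply: (can_inj (mulKmx uP)); rewrite mulKVmx // /precond_mx mulmx_block.
rewrite !mulmx1 mulKVmx // !mul0mx !mulmx0 !addr0 -scalemxAl -scalemxAr scalerA.
rewrite mulKVmx // mulrN -expr2 sqrr_sign scaleN1r /schur_mx mulmxA.
by rewrite opprD addrCA subrr addr0.
Qed.

(** The rescaled polynomial is p(c z), whose value at [c *: T] is p(c^2 T); thus both signs lead to
    the same p(T). *)
Lemma mxpoly_eval_scale (R : realType) m (p : {poly R}) (T : 'M[R]_m) (c : R) :
  c ^+ 2 = 1 ->
  mxpoly_eval (\poly_(i < size p) (p`_i * c ^+ i)) (c *: T) = mxpoly_eval p T.
Proof.
move=> c2; rewrite (mxpoly_eval_wide _ (size_poly _ _)).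
apply: eq_bigr => i _; rewrite coef_poly ltn_ord.
have -> : (c *: T) ^+ i = c ^+ i *: T ^+ i.
  elim: (i : nat) => [|j IH]; first by rewrite !expr0 scale1r.
  by rewrite !exprS IH -!mulmxE -scalemxAl -scalemxAr scalerA.
by rewrite scalerA -mulrA -exprD addnn -mul2n exprM c2 expr1n mulr1.
Qed.

Lemma residual_block_bound (R : realType) n m (X : 'M[R]_(n, m)) (T : 'M[R]_m)
    (c : R) (p : {poly R}) (r : 'cV[R]_(n + m)) :
  c ^+ 2 = 1 ->
  let q := (1 - 'X) * \poly_(i < size p) (p`_i * c ^+ i) in
  norm2 (mxpoly_eval q (block_mx 1%:M X 0 (c *: T)) *m r) <=
  (1 + opnorm2 X + opnorm2 T) * opnorm2 (mxpoly_eval p T) * norm2 r.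
Proof.
move=> c2 /=; rewrite mxpoly_evalM mxpoly_eval1BX.
set p' := \poly_(i < _) _.
have [Z [W ->]] := mxpoly_eval_block p' X (c *: T).
rewrite mxpoly_eval_scale // scalar_mx_block opp_block_mx add_block_mx.
rewrite subrr oppr0 !add0r mulmx_block !mul0mx !mulmx0 !add0r.
rewrite -[r in leLHS]vsubmxK mul_block_col !mul0mx !add0r -!mulmxA.
have c1 : `|c| = 1 by apply/eqP; rewrite -sqr_norm_eq1 c2.
(* With y = p(T) [dsubmx r], the two blocks of q(M) r are -X y and (1 - c T) y; adding their norms
   yields the constant. *)
set y := _ *m dsubmx r.
have yr : norm2 y <= opnorm2 (mxpoly_eval p T) * norm2 r.
  rewrite (le_trans (norm2_mulmx _ _)) //.
  by rewrite ler_wpM2l ?opnorm2_ge0 ?norm2_dsubmx_le.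
apply: le_trans (norm2_col_mx_le _ _) _.
have k0 : 0 <= 1 + opnorm2 X + opnorm2 T by rewrite !addr_ge0 ?opnorm2_ge0.
rewrite -mulrA; apply: le_trans (ler_wpM2l k0 yr).
have norm2N l (x : 'cV[R]_l) : norm2 (- x) = norm2 x.
  by rewrite -scaleN1r norm2Z normrN1 mul1r.
rewrite mulNmx norm2N mulmxBl mul1mx.
rewrite [1 + _]addrC -addrA mulrDl lerD ?norm2_mulmx // mulrDl mul1r.
rewrite (le_trans (norm2D _ _)) // norm2N lerD2l -scalemxAl norm2Z c1 mul1r.
exact: norm2_mulmx.
Qed.

Theorem lemmaA1 (R : realType) (n m k : nat)
    (A : 'M[R]_n) (B C : 'M[R]_(m, n)) (D Shat : 'M[R]_m) (neg : bool)
    (r0 rk : 'cV[R]_(n + m)) :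
  (1 <= k)%N ->
  A \in unitmx ->
  Shat \in unitmx ->
  r0 != 0 ->
  gmres_residual (invmx (precond_mx neg A C Shat) *m saddle_mx A B C D)
    r0 k rk ->
  exists mu : R,
    is_minimum [set opnorm2 (mxpoly_eval p (invmx Shat *m schur_mx A B C D))
                 | p in residual_poly k.-1] mu /\
    norm2 rk / norm2 r0 <=
      (1 + opnorm2 (invmx A *m B^T) + opnorm2 (invmx Shat *m schur_mx A B C D))
      * mu.
Proof.
move=> k1 uA uS r0_neq0; rewrite precond_saddle_mx // => -[_ [_ rk_min]].
set T := invmx Shat *m _.
have [mu mu_min] := residual_poly_opnorm2_min k.-1 T.
exists mu; split=> //; case: mu_min => -[p [pk p0] <-] _.
have r0_gt0 : 0 < norm2 r0.
  by rewrite lt_def norm2_ge0 andbT; apply: contra_neq r0_neq0; exact: norm2_eq0.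
rewrite ler_pdivrMr //.
have c2 : (- (-1) ^+ neg : R) ^+ 2 = 1 by rewrite sqrrN sqrr_sign.
(* The GMRES minimum is compared with the single competitor q(z) = (1 - z) p(c z). *)
apply: le_trans (residual_block_bound _ T p r0 c2); apply: rk_min.
eexists; last reflexivity; split.
  (* The factors have sizes 2 and at most [k.-1.+1], which is [k] because [k] is positive; so q has
     size at most [k.+1]. *)
  rewrite (leq_trans (size_mul_leq _ _)) //.
  have -> : size (1 - 'X : {poly R}) = 2%N by rewrite -opprB size_polyN size_XsubC.
  by rewrite /= ltnS -(prednK k1) (leq_trans (size_poly _ _)).
have p1 : p`_0 = 1 by rewrite -horner_coef0.
(* [\poly_(i < size p)] has the intended constant coefficient only if index 0 is in range. *)
have p_gt0 : (0 < size p)%N.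
  rewrite lt0n size_poly_eq0; apply: contra_eq_neq p1 => ->.
  by rewrite coef0 eq_sym oner_neq0.
rewrite !horner_coef0 coefM big_ord1 coef_poly p_gt0 p1.
by rewrite coefB coef1 coefX subr0 !mulr1.
Qed.
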